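(* Let $X$ be a nonempty completely regular space, $E\ne\{0\}$ a Banach space and $D=C(X,E)$. Let $A=C(X,L(E))\subset L(D)$ act by multiplication, $(af)(x)=a(x)f(x)$, let $G$ be a discrete group acting on $X$ by a group of homeomorphisms $\{t_g\}_{g\in G}$ ($t_{gh}=t_g\circ t_h$), and let $T_g$ be the isometry of $D$ given by $(T_gf)(x)=f(t_g^{-1}(x))$. Let $B(A,T_g)\subset L(D)$ be the algebra generated by $A$ and $\{T_g\}_{g\in G}$ and let $B(\bar A,V_g)$ be the regular representation corresponding to $A$ and $\{\hat T_g\}_{g\in G}$ in the space $H=l_0(G,C(X,E))$ (or in $H=l^\infty(G,C(X,E))$). If $G$ acts topologically freely on $X$, then the mappings $$a\mapsto\bar a,\ a\in A,\qquad T_g\mapsto V_g,\ g\in G,$$ establish an isomorphism $B(A,T_g)\cong B(\bar A,V_g)$.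
   Context: All Banach spaces are complex, completely regular spaces are Hausdorff. $L(E)$ is the algebra of bounded linear operators on $E$; $C(X,B)$ is the space of bounded continuous functions $X\to B$ with the sup norm. $l_0(G,D)$ is the space of functions $G\to D$ tending to zero at infinity, with the sup norm. $\hat T_g(a)=T_gaT_g^{-1}$, so $(\hat T_g(a))(x)=a(t_g^{-1}(x))$. $B(A,T_g)$ is the norm closure in $L(D)$ of the finite sums $\sum_{g\in F}a_gT_g$, $a_g\in A$. Regular representation in a space $H$ of $D$-valued functions on $G$: $(V_{g_0}\xi)(g)=\xi(gg_0)$, and for $a\in A$, $(\bar a\xi)(g)=\hat T_g(a)\xi(g)$; $\bar A=\{\bar a:a\in A\}\subset L(H)$; $B(\bar A,V_g)$ is the norm closure in $L(H)$ of the finite sums $\sum\bar a_gV_g$. ''$\cong$'' is isometric isomorphism of Banach algebras. $G$ acts topologically freely if for every $g\in G$, $g\neq e$, the set $\{x\in X:t_g(x)=x\}$ has empty interior. *)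

(* Defs.v *)
(* The complex field is R[i] for R : realType; the norm of a normedModType R[i]
   takes its (real) values in R[i]. *)
From HB Require Import structures.
From mathcomp Require Import all_boot all_order all_algebra finmap.
From mathcomp Require Import all_classical all_reals all_analysis.
From mathcomp.real_closed Require Import complex.

Set Implicit Arguments.
Unset Strict Implicit.
Unset Printing Implicit Defensive.

Import Order.TTheory GRing.Theory Num.Theory.
Import numFieldNormedType.Exports.

Local Open Scope classical_set_scope.
Local Open Scope ring_scope.

Section SupNorm.
Context {R : realType} {T : Type} {V : normedModType R[i]}.
Implicit Types (A : set T) (f g : T -> V) (M : R[i]).

(* The supremum of `|f x| over x in A; it is meaningful when f is bounded on
   A, and is 0 when A is empty. *)
Definition supnorm A f : R[i] :=
  real_complex R (sup [set complex.Re `|f x| | x in A]).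

Lemma normC_Re (U : normedModType R[i]) (x : U) :
  `|x| = real_complex R (complex.Re `|x|).
Proof.
have := normr_ge0 x; rewrite lecE /= => /andP[/eqP + _].
by case: `|x| => a b /= ->.
Qed.

Lemma supnorm_ub A f M x : (forall y, A y -> `|f y| <= M) -> A x ->
  `|f x| <= supnorm A f.
Proof.
move=> fM Ax; rewrite normC_Re /supnorm lecR; apply: ub_le_sup; last by exists x.
exists (complex.Re M) => _ [y Ay <-].
by have := fM _ Ay; rewrite lecE => /andP[].
Qed.

Lemma supnorm_le A f M : 0 <= M -> (forall x, A x -> `|f x| <= M) ->
  supnorm A f <= M.
Proof.
move=> M0 fM; have ME : M = real_complex R (complex.Re M).
  by move: M0; rewrite lecE /= => /andP[/eqP]; case: (M) => a b /= ->.
rewrite ME /supnorm lecR.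
have [->|/set0P[x Ax]] := eqVneq A set0; last first.
  apply: ge_sup; first by exists (complex.Re `|f x|), x.
  by move=> _ [y Ay <-]; have := fM _ Ay; rewrite lecE => /andP[].
by rewrite image_set0 sup0; move: M0; rewrite ME lecE => /andP[].
Qed.

Lemma supnorm_ge0 A f M : (forall x, A x -> `|f x| <= M) -> 0 <= supnorm A f.
Proof.
move=> fM; have [->|/set0P[x Ax]] := eqVneq A set0.
  by rewrite /supnorm image_set0 sup0.
exact: le_trans (supnorm_ub fM Ax).
Qed.

Lemma supnormD A f g M N :
  (forall x, A x -> `|f x| <= M) -> (forall x, A x -> `|g x| <= N) ->
  supnorm A (f + g) <= supnorm A f + supnorm A g.
Proof.
move=> fM gN; apply: supnorm_le.
  by rewrite addr_ge0 ?(supnorm_ge0 fM) ?(supnorm_ge0 gN).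
move=> x Ax; apply: le_trans (ler_normD _ _) _.
by rewrite lerD ?(supnorm_ub fM) ?(supnorm_ub gN).
Qed.

Lemma supnormZ A f M (c : R[i]) : (forall x, A x -> `|f x| <= M) ->
  supnorm A (c *: f) = `|c| * supnorm A f.
Proof.
have le_sup (d : R[i]) (h : T -> V) N : (forall x, A x -> `|h x| <= N) ->
    supnorm A (d *: h) <= `|d| * supnorm A h.
  move=> hN; apply: supnorm_le; first by rewrite mulr_ge0 ?(supnorm_ge0 hN).
  by move=> x Ax; rewrite /= normrZ ler_wpM2l ?(supnorm_ub hN).
move=> fM; apply/eqP; rewrite eq_le (le_sup _ _ _ fM) /=.
have cfM x : A x -> `|(c *: f) x| <= `|c| * M.
  by move=> Ax; rewrite /= normrZ ler_wpM2l ?fM.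
have [->|c0] := eqVneq c 0.
  by rewrite normr0 mul0r; apply: (@supnorm_ge0 _ _ 0) => x _; rewrite /= scale0r normr0.
rewrite -ler_pdivlMl ?normr_gt0// -normfV.
by apply: le_trans (le_sup c^-1 _ _ cfM); rewrite scalerA mulVf// scale1r.
Qed.

End SupNorm.

Section FunctionSpaces.
Context {R : realType}.

(* A linear space of bounded functions T -> V; [supfun S] is that space with the
   sup norm.  [Cb X B] (written C(X, B) in the literature), l0 and linfty are
   instances. *)
Record fspace (T : Type) (V : normedModType R[i]) := FSpace {
  fs_pred :> {pred T -> V} ;
  fs_submod : submod_closed fs_pred ;
  fs_bounded : forall f, f \in fs_pred -> exists M : R[i], forall x, `|f x| <= M
}.

Record supfun T V (S : fspace T V) := SupFun {
  fsval :> T -> V ;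
  fsvalP : fsval \in fs_pred S
}.

Section Instances.
Context {T : Type} {V : normedModType R[i]} (S : fspace T V).

HB.instance Definition _ := [isSub for @fsval T V S].
HB.instance Definition _ := [Choice of supfun S by <:].
HB.instance Definition _ :=
  GRing.isSubmodClosed.Build R[i] (T -> V) (fs_pred S) (fs_submod S).
HB.instance Definition _ := [SubChoice_isSubLmodule of supfun S by <:].

Let fs_norm (f : supfun S) : R[i] := supnorm setT f.

Let fs_bound (f : supfun S) : exists M : R[i], forall x, setT x -> `|f x| <= M.
Proof. by have [M fM] := fs_bounded (fsvalP f); exists M => x _. Qed.

Let fs_normD (f g : supfun S) : fs_norm (f + g) <= fs_norm f + fs_norm g.
Proof.
by have [M fM] := fs_bound f; have [N gN] := fs_bound g; exact: supnormD fM gN.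
Qed.

Let fs_normZ (c : R[i]) (f : supfun S) : fs_norm (c *: f) = `|c| * fs_norm f.
Proof. by have [M fM] := fs_bound f; exact: supnormZ fM. Qed.

Let fs_norm0 (f : supfun S) : fs_norm f = 0 -> f = 0.
Proof.
have [M fM] := fs_bound f => f0; apply/val_inj/funext => x /=.
by apply/eqP; rewrite -normr_le0 -f0 (supnorm_ub fM).
Qed.

HB.instance Definition _ :=
  Lmodule_isNormed.Build R[i] (supfun S) fs_normD fs_normZ fs_norm0.

Lemma fsnormE (f : supfun S) : `|f| = supnorm setT f. Proof. by []. Qed.

Lemma fsnorm_ub (f : supfun S) x : `|f x| <= `|f|.
Proof. by have [M fM] := fs_bound f; rewrite fsnormE (supnorm_ub fM). Qed.

Lemma fsnorm_le (f : supfun S) (M : R[i]) :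
  0 <= M -> (forall x, `|f x| <= M) -> `|f| <= M.
Proof. by move=> M0 fM; apply: supnorm_le => // x _. Qed.

Lemma fsP (f g : supfun S) : (forall x, f x = g x) -> f = g.
Proof. by move=> fg; apply/val_inj/funext. Qed.

End Instances.

Section Cb.
Context (X : topologicalType) (B : normedModType R[i]).

Definition Cb_pred : {pred X -> B} := fun f =>
  `[< continuous f /\ exists M : R[i], forall x, `|f x| <= M >].

Lemma Cb_submod : submod_closed Cb_pred.
Proof.
split=> [|c f g /asboolP[cf [M fM]] /asboolP[cg [N gN]]]; apply/asboolP.
  by split; [exact: cst_continuous|exists 0 => x; rewrite normr0].
split; first by move=> x; apply: cvgD (cg x); apply: cvgZr (cf x).
exists (`|c| * M + N) => x; apply: le_trans (ler_normD _ _) _.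
by rewrite /= normrZ lerD// ler_wpM2l.
Qed.

Lemma Cb_bounded f : f \in Cb_pred -> exists M : R[i], forall x, `|f x| <= M.
Proof. by case/asboolP. Qed.

Definition Cb_space := FSpace Cb_submod Cb_bounded.
Definition Cb := supfun Cb_space.

End Cb.

Section l_spaces.
Context (G : choiceType) (D : normedModType R[i]).

Definition linfty_pred : {pred G -> D} := fun xi =>
  `[< exists M : R[i], forall g, `|xi g| <= M >].

(* Tending to zero at infinity, for the discrete topology on G. *)
Definition l0_pred : {pred G -> D} := fun xi =>
  `[< forall e : R[i], 0 < e ->
      exists F : {fset G}, forall g, g \notin F -> `|xi g| < e >].

Lemma linfty_submod : submod_closed linfty_pred.
Proof.
split=> [|c f g /asboolP[M fM] /asboolP[N gN]]; apply/asboolP.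
  by exists 0 => x; rewrite normr0.
exists (`|c| * M + N) => x; apply: le_trans (ler_normD _ _) _.
by rewrite /= normrZ lerD// ler_wpM2l.
Qed.

Lemma linfty_bounded f :
  f \in linfty_pred -> exists M : R[i], forall x, `|f x| <= M.
Proof. by move/asboolP. Qed.

Lemma l0_submod : submod_closed l0_pred.
Proof.
split=> [|c f g /asboolP f0 /asboolP g0]; apply/asboolP => e e0.
  by exists fset0 => g _; rewrite normr0.
have e2 : 0 < e / 2 by rewrite divr_gt0.
have c1 : 0 < `|c| + 1 by rewrite ltr_wpDl.
have [F fF] := f0 _ (divr_gt0 e2 c1); have [F' gF'] := g0 _ e2.
exists (F `|` F')%fset => x; rewrite inE negb_or => /andP[xF xF'].
apply: le_lt_trans (ler_normD _ _) _; rewrite [e]splitr.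
apply: ltrD; last exact: gF'.
rewrite /= normrZ; apply: (@le_lt_trans _ _ ((`|c| + 1) * `|f x|)).
  by rewrite ler_wpM2r// lerDl.
by rewrite -ltr_pdivlMl// mulrC fF.
Qed.

Lemma l0_bounded f : f \in l0_pred -> exists M : R[i], forall x, `|f x| <= M.
Proof.
move/asboolP => /(_ 1 ltr01)[F fF]; exists (1 + \sum_(g <- F) `|f g|) => x.
have [xF|xF] := boolP (x \in F).
  rewrite (big_fsetD1 x)//= addrCA lerDl addr_ge0// sumr_ge0// => *; exact: normr_ge0.
rewrite (le_trans (ltW (fF _ xF)))// lerDl sumr_ge0// => *; exact: normr_ge0.
Qed.

Definition linfty_space := FSpace linfty_submod linfty_bounded.
Definition l0_space := FSpace l0_submod l0_bounded.

End l_spaces.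

End FunctionSpaces.

Section BoundedOperators.
Context {R : realType}.

Section Def.
Context (V W : normedModType R[i]).

Definition bop_pred : {pred V -> W} := fun f =>
  `[< linear f /\ exists M : R[i], forall x, `|f x| <= M * `|x| >].

Lemma bop_submod : submod_closed bop_pred.
Proof.
split=> [|c f g /asboolP[lf [M fM]] /asboolP[lg [N gN]]]; apply/asboolP.
  split; first by move=> k x y /=; rewrite scaler0 addr0.
  by exists 0 => x; rewrite normr0 mul0r.
split.
  have E z : (c *: f + g) z = c *: f z + g z by [].
  move=> k x y; rewrite !E.
  by rewrite lf lg !scalerDr !scalerA [c * k]mulrC addrACA.
exists (`|c| * M + N) => x; apply: le_trans (ler_normD _ _) _.
by rewrite /= normrZ mulrDl lerD// -mulrA ler_wpM2l.
Qed.

(* Bounded operators, normed by opnorm below. *)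
Record bop := Bop { bop_val :> V -> W ; bopP : bop_val \in bop_pred }.

HB.instance Definition _ := [isSub for bop_val].
HB.instance Definition _ := [Choice of bop by <:].
HB.instance Definition _ :=
  GRing.isSubmodClosed.Build R[i] (V -> W) bop_pred bop_submod.
HB.instance Definition _ := [SubChoice_isSubLmodule of bop by <:].

Lemma bop_linear (f : bop) : linear f.
Proof. by case/asboolP: (bopP f). Qed.

HB.instance Definition _ (f : bop) :=
  GRing.isLinear.Build R[i] V W *:%R f (bop_linear f).

Definition opnorm (f : bop) : R[i] := supnorm [set x | `|x| <= 1] f.

Let opnorm_bound (f : bop) :
  exists M : R[i], forall x, [set x | `|x| <= 1] x -> `|f x| <= M.
Proof.
case/asboolP: (bopP f) => _ [M fM]; exists `|M| => x /= x1.
apply: le_trans (fM x) _; have M0 : 0 <= `|f x| := normr_ge0 _.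
have := le_trans M0 (fM x); have := normr_ge0 x.
rewrite le_eqVlt => /predU1P[<- _|x0 Mx]; first by rewrite mulr0.
have {}M0 : 0 <= M by rewrite -(pmulr_lge0 _ x0).
by rewrite ger0_norm// ler_piMr.
Qed.

Lemma opnorm_ub (f : bop) x : `|f x| <= opnorm f * `|x|.
Proof.
have [->|x0] := eqVneq x 0; first by rewrite linear0 !normr0 mulr0.
have nx : 0 < `|x| by rewrite normr_gt0.
have [M fM] := opnorm_bound f.
rewrite -ler_pdivrMr// mulrC.
have -> : `|x|^-1 * `|f x| = `|f (`|x|^-1 *: x)|.
  by rewrite linearZ/= normrZ normfV normr_id.
by apply: supnorm_ub fM _ => /=; rewrite normrZ normfV normr_id mulVf// gt_eqF.
Qed.

Let opnormD (f g : bop) : opnorm (f + g) <= opnorm f + opnorm g.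
Proof.
have [M fM] := opnorm_bound f; have [N gN] := opnorm_bound g.
exact: supnormD fM gN.
Qed.

Let opnormZ (c : R[i]) (f : bop) : opnorm (c *: f) = `|c| * opnorm f.
Proof. by have [M fM] := opnorm_bound f; exact: supnormZ fM. Qed.

Let opnorm0 (f : bop) : opnorm f = 0 -> f = 0.
Proof.
move=> f0; apply/val_inj/funext => x /=; apply/eqP.
by rewrite -normr_le0 (le_trans (opnorm_ub _ _))// f0 mul0r.
Qed.

HB.instance Definition _ :=
  Lmodule_isNormed.Build R[i] bop opnormD opnormZ opnorm0.

Lemma bopnormE (f : bop) : `|f| = opnorm f. Proof. by []. Qed.

Lemma bopnorm_ub (f : bop) x : `|f x| <= `|f| * `|x|.
Proof. exact: opnorm_ub. Qed.

Lemma bop_ext (f g : bop) : (forall x, f x = g x) -> f = g.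
Proof. by move=> fg; apply/val_inj/funext. Qed.

Lemma bop_mk (f : V -> W) (M : R[i]) :
  linear f -> (forall x, `|f x| <= M * `|x|) -> f \in bop_pred.
Proof. by move=> lf fM; apply/asboolP; split; last exists M. Qed.

End Def.

Section Ring.
Context {V : normedModType R[i]}.

Lemma bop_one_subproof : (@idfun V) \in @bop_pred V V.
Proof. by apply: (@bop_mk _ _ _ 1) => // x; rewrite mul1r. Qed.

Definition bop_one : bop V V := Bop bop_one_subproof.

Lemma bop_mul_subproof (f g : bop V V) : (f \o g) \in @bop_pred V V.
Proof.
apply: (@bop_mk _ _ _ (`|f| * `|g|)) => [c x y|x] /=; first by rewrite !linearP.
apply: le_trans (bopnorm_ub _ _) _.
by rewrite -mulrA ler_wpM2l// bopnorm_ub.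
Qed.

Definition bop_mul (f g : bop V V) : bop V V := Bop (bop_mul_subproof f g).

Let bop_mulA : associative bop_mul.
Proof. by move=> f g h; apply: bop_ext. Qed.
Let bop_mul1l : left_id bop_one bop_mul.
Proof. by move=> f; apply: bop_ext. Qed.
Let bop_mul1r : right_id bop_one bop_mul.
Proof. by move=> f; apply: bop_ext. Qed.
Let bop_mulDl : left_distributive bop_mul +%R.
Proof. by move=> f g h; apply: bop_ext. Qed.
Let bop_mulDr : right_distributive bop_mul +%R.
Proof. by move=> f g h; apply: bop_ext => x /=; rewrite linearD. Qed.

HB.instance Definition _ := GRing.Zmodule_isPzRing.Build (bop V V)
  bop_mulA bop_mul1l bop_mul1r bop_mulDl bop_mulDr.

Lemma bopME (f g : bop V V) x : (f * g) x = f (g x). Proof. by []. Qed.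

End Ring.

(* The norm closure of the finite sums of a_g U_g with a_g in A. *)
Definition op_algebra (G : groupType) (V : normedModType R[i])
    (A : set (bop V V)) (U : G -> bop V V) : set (bop V V) :=
  closure [set S | exists (F : {fset G}) (a : G -> bop V V),
    (forall g, A (a g)) /\ S = \sum_(g <- F) a g * U g].

(* An isometric isomorphism from the algebra B of operators onto the algebra B';
   Phi is a total function of which only the values on B matter. *)
Definition banach_algebra_isom (V W : normedModType R[i])
    (B : set (bop V V)) (B' : set (bop W W)) (Phi : bop V V -> bop W W) :=
  [/\ set_bij B B' Phi,
      forall (c : R[i]) P Q, B P -> B Q ->
        Phi (c *: P + Q) = c *: Phi P + Phi Q,
      forall P Q, B P -> B Q -> Phi (P * Q) = Phi P * Phi Q &
      forall P, B P -> `|Phi P| = `|P|].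

End BoundedOperators.

Notation "'L(' V ')'" := (bop V V) (format "'L(' V ')'") : type_scope.

(* Each [act g] is a homeomorphism, with inverse [act g^-1]. *)
Record homeo_action (G : groupType) (X : topologicalType) := HomeoAction {
  act :> G -> X -> X ;
  act1 : forall x, act 1%g x = x ;
  actM : forall g h x, act (g * h)%g x = act g (act h x) ;
  act_continuous : forall g, continuous (act g)
}.

Lemma actK (G : groupType) (X : topologicalType) (t : homeo_action G X) g :
  cancel (t g) (t g^-1%g).
Proof. by move=> x; rewrite -actM mulVg act1. Qed.

Lemma actVK (G : groupType) (X : topologicalType) (t : homeo_action G X) g :
  cancel (t g^-1%g) (t g).
Proof. by move=> x; rewrite -actM mulgV act1. Qed.

Definition topologically_free (G : groupType) (X : topologicalType)
    (t : homeo_action G X) :=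
  forall g, g != 1%g -> interior [set x | t g x = x] = set0.

Section WeightedShifts.
Context {R : realType} {X : topologicalType} {E : normedModType R[i]}.
Local Notation D := (Cb X E).

Lemma mulfun_subproof (a : Cb X L(E)) (f : D) :
  (fun x => a x (f x)) \in @Cb_pred R X E.
Proof.
have /asboolP[ca _] := fsvalP a; have /asboolP[cf _] := fsvalP f.
apply/asboolP; split; last first.
  exists (`|a| * `|f|) => x; apply: le_trans (bopnorm_ub _ _) _.
  by rewrite ler_pM ?fsnorm_ub.
move=> x; apply/cvgrPdist_le => e e0.
have N1 : 0 < `|a x| + `|f| + 1 by rewrite ltr_wpDl// addr_ge0.
have d0 : 0 < e / (`|a x| + `|f| + 1) by rewrite divr_gt0.
have /cvgrPdist_le/(_ _ d0) ha := ca x; have /cvgrPdist_le/(_ _ d0) hf := cf x.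
near=> y.
have -> : a x (f x) - a y (f y) = a x (f x - f y) + (a x - a y) (f y).
  by rewrite linearB /= addrA subrK.
apply: le_trans (ler_normD _ _) _.
apply: (@le_trans _ _ ((`|a x| + `|f|) * (e / (`|a x| + `|f| + 1)))).
  rewrite mulrDl; apply: lerD.
    by apply: le_trans (bopnorm_ub _ _) _; rewrite ler_wpM2l//; near: y.
  apply: le_trans (bopnorm_ub _ _) _; rewrite mulrC ler_pM ?fsnorm_ub//.
  by near: y.
rewrite mulrA ler_pdivrMr// mulrC ler_wpM2l ?(ltW e0)// lerDl//.
Unshelve. all: by end_near. Qed.

Definition mulfun (a : Cb X L(E)) (f : D) : D :=
  @SupFun _ _ _ (Cb_space X E) _ (mulfun_subproof a f).

Lemma mulop_subproof (a : Cb X L(E)) : mulfun a \in @bop_pred R D D.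
Proof.
apply: (@bop_mk R _ _ _ `|a|) => [c f g|f].
  by apply: fsP => x /=; rewrite linearP.
apply: fsnorm_le => [|x]; first by rewrite mulr_ge0.
by apply: le_trans (bopnorm_ub _ _) _; rewrite ler_pM ?fsnorm_ub.
Qed.

Definition mulop (a : Cb X L(E)) : L(D) := Bop (mulop_subproof a).

(* The algebra C(X, L(E)), as a subset of L(D). *)
Definition mulalg : set L(D) := range mulop.

Context {G : groupType} (t : homeo_action G X).

Lemma shiftfun_subproof g (f : D) : (fun x => f (t g^-1%g x)) \in @Cb_pred R X E.
Proof.
have /asboolP[cf _] := fsvalP f; apply/asboolP; split.
  by move=> x; apply: continuous_comp; [exact: act_continuous|exact: cf].
by exists `|f| => x; exact: fsnorm_ub.
Qed.

Definition shiftfun g (f : D) : D :=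
  @SupFun _ _ _ (Cb_space X E) _ (shiftfun_subproof g f).

Lemma shiftop_subproof g : shiftfun g \in @bop_pred R D D.
Proof.
apply: (@bop_mk R _ _ _ 1) => [c f h|f]; first exact: fsP.
by rewrite mul1r; apply: fsnorm_le => // x; exact: fsnorm_ub.
Qed.

(* T_g *)
Definition shiftop g : L(D) := Bop (shiftop_subproof g).

Lemma shiftopM g h : shiftop (g * h)%g = shiftop g * shiftop h.
Proof.
by apply: bop_ext => f; apply: fsP => x /=; rewrite invgM actM.
Qed.

Lemma shiftop1 : shiftop 1%g = 1.
Proof. by apply: bop_ext => f; apply: fsP => x /=; rewrite invg1 act1. Qed.

Lemma shiftop_norm1 g : `|shiftop g| <= 1.
Proof.
apply: supnorm_le => // f /= f1; apply: le_trans f1.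
by apply: fsnorm_le => // x; exact: fsnorm_ub.
Qed.

(* b |-> T_g b T_g^-1 *)
Definition shiftconj g (b : L(D)) : L(D) := shiftop g * b * shiftop g^-1%g.

Lemma shiftconj_mulop g a x f :
  shiftconj g (mulop a) f x = a (t g^-1%g x) (f x).
Proof. by rewrite /= invgK -actM mulgV act1. Qed.

Lemma shiftconj_le g b f : `|shiftconj g b f| <= `|b| * `|f|.
Proof.
have T1 h (k : D) : `|shiftop h k| <= `|k|.
  apply: le_trans (bopnorm_ub _ _) _.
  by rewrite -[leRHS]mul1r ler_wpM2r// shiftop_norm1.
apply: le_trans (T1 _ _) _; apply: le_trans (bopnorm_ub _ _) _.
by rewrite ler_wpM2l.
Qed.

(* The spaces H of D-valued functions on G that carry the regular
   representation. *)
Record regspace := RegSpace {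
  rs_space :> fspace G D ;
  rs_shift : forall (g0 : G) xi, xi \in rs_space ->
    (fun g => xi (g * g0)%g) \in rs_space ;
  rs_diag : forall (b : L(D)) xi, xi \in rs_space ->
    (fun g => shiftconj g b (xi g)) \in rs_space
}.

Section Regular.
Variable H : regspace.

Definition regshift (g0 : G) (xi : supfun H) : supfun H :=
  SupFun (rs_shift g0 (fsvalP xi)).

Lemma regshift_subproof g0 : regshift g0 \in @bop_pred R (supfun H) (supfun H).
Proof.
apply: (@bop_mk R _ _ _ 1) => [c f h|f]; first exact: fsP.
by rewrite mul1r; apply: fsnorm_le => // x; exact: (fsnorm_ub f).
Qed.

(* V_g *)
Definition regV g0 : L(supfun H) := Bop (regshift_subproof g0).

Definition regdiag (b : L(D)) (xi : supfun H) : supfun H :=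
  SupFun (rs_diag b (fsvalP xi)).

Lemma regdiag_subproof b : regdiag b \in @bop_pred R (supfun H) (supfun H).
Proof.
apply: (@bop_mk R _ _ _ `|b|) => [c f h|f].
  by apply: fsP => g; exact: (linearP (shiftconj g b)).
apply: fsnorm_le => [|g]; first by rewrite mulr_ge0.
by apply: le_trans (shiftconj_le _ _ _) _; rewrite ler_wpM2l ?fsnorm_ub.
Qed.

(* (abar xi)(g) = (T_g a T_g^-1)(xi(g)), for any operator a on D *)
Definition regbar b : L(supfun H) := Bop (regdiag_subproof b).

End Regular.

Lemma linfty_shift (g0 : G) (xi : G -> D) : xi \in linfty_space G D ->
  (fun g => xi (g * g0)%g) \in linfty_space G D.
Proof. by move=> /asboolP[M xiM]; apply/asboolP; exists M. Qed.

Lemma linfty_diag (b : L(D)) (xi : G -> D) : xi \in linfty_space G D ->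
  (fun g => shiftconj g b (xi g)) \in linfty_space G D.
Proof.
move=> /asboolP[M xiM]; apply/asboolP; exists (`|b| * M) => g.
by apply: le_trans (shiftconj_le _ _ _) _; rewrite ler_wpM2l.
Qed.

Lemma l0_shift (g0 : G) (xi : G -> D) : xi \in l0_space G D ->
  (fun g => xi (g * g0)%g) \in l0_space G D.
Proof.
move=> /asboolP xi0; apply/asboolP => e /xi0[F xiF].
exists [fset (g * g0^-1)%g | g in F]%fset => g gF; apply: xiF.
apply: contra gF => gF; apply/imfsetP; exists (g * g0)%g => //.
by rewrite -mulgA mulgV mulg1.
Qed.

Lemma l0_diag (b : L(D)) (xi : G -> D) : xi \in l0_space G D ->
  (fun g => shiftconj g b (xi g)) \in l0_space G D.
Proof.
move=> /asboolP xi0; apply/asboolP => e e0.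
have b1 : 0 < `|b| + 1 by rewrite ltr_wpDl.
have [F xiF] := xi0 _ (divr_gt0 e0 b1); exists F => g gF.
apply: le_lt_trans (shiftconj_le _ _ _) _.
apply: (@le_lt_trans _ _ ((`|b| + 1) * `|xi g|)).
  by rewrite ler_wpM2r// lerDl.
by rewrite -ltr_pdivlMl// mulrC xiF.
Qed.

Definition linfty_reg : regspace := RegSpace linfty_shift linfty_diag.
Definition l0_reg : regspace := RegSpace l0_shift l0_diag.

(* a |-> abar, T_g |-> V_g establish B(A, T_g) ~ B(Abar, V_g). *)
Definition regular_isom (H : regspace) :=
  exists Phi : L(D) -> L(supfun H),
    [/\ banach_algebra_isom (op_algebra mulalg shiftop)
          (op_algebra (regbar H @` mulalg) (regV H)) Phi,
        forall a, mulalg a -> Phi a = regbar H a &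
        forall g, Phi (shiftop g) = regV H g].

End WeightedShifts.

(* Main.v *)
(* For S = sum_g a_g T_g and its image S' = sum_g abar_g V_g, both norms equal the
   supremum over y in X and over vectors e_g in the unit ball of E of
   |sum_g a_g(y) e_g|.  For S' this holds because the values of a vector of H at
   the points of an orbit of G can be prescribed independently.  For S, the
   vectors f(t_g^-1(y)) can be prescribed with |f| <= 1 as soon as the finitely
   many points t_g^-1(y) are distinct; topological freeness makes such y dense,
   and y |-> sum_g a_g(y) e_g is continuous.  An isometric multiplicative linear
   relation between two sets of operators extends to their closures since L(D) and
   L(H) are complete. *)
Require Import Defs.
From HB Require Import structures.
From mathcomp Require Import all_boot all_order all_algebra finmap.
From mathcomp Require Import all_classical all_reals all_analysis.
From mathcomp.real_closed Require Import complex.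

Set Implicit Arguments.
Unset Strict Implicit.
Unset Printing Implicit Defensive.

Import Order.TTheory GRing.Theory Num.Theory.
Import numFieldNormedType.Exports.

Local Open Scope classical_set_scope.
Local Open Scope ring_scope.

(** * Completeness of spaces of functions and of operators *)

Section Completeness.
Context {R : realType}.

Definition seq_cauchy (V : normedModType R[i]) (u : nat -> V) :=
  forall e : R[i], 0 < e -> exists N, forall m n,
    (N <= m)%N -> (N <= n)%N -> `|u m - u n| <= e.

Definition seq_lim (V : normedModType R[i]) (u : nat -> V) (l : V) :=
  forall e : R[i], 0 < e -> exists N, forall n, (N <= n)%N -> `|u n - l| <= e.

(** A predicate on sequences, so that completeness passes from [E] to [Cb], to the spaces on [G] and
    to operators by explicit estimates. *)
Definition seq_complete (V : normedModType R[i]) :=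
  forall u : nat -> V, seq_cauchy u -> exists l, seq_lim u l.

Lemma seq_lim_dist (V : normedModType R[i]) (u : nat -> V) l v c N :
  seq_lim u l -> (forall n, (N <= n)%N -> `|v - u n| <= c) -> `|v - l| <= c.
Proof.
move=> ul vu; apply/ler_addgt0Pr => e e0; have [N' uN] := ul _ e0.
rewrite -(subrKA (u (maxn N N'))) (le_trans (ler_normD _ _))//.
by rewrite lerD ?vu ?uN ?leq_maxl ?leq_maxr.
Qed.

Lemma seq_lim_linear (V : normedModType R[i]) (u v : nat -> V) l m (c : R[i]) :
  seq_lim u l -> seq_lim v m -> seq_lim (fun n => c *: u n + v n) (c *: l + m).
Proof.
move=> ul vm e e0; have c0 : 0 < `|c| + 1 by rewrite ltr_wpDl.
have [N uN] := ul _ (divr_gt0 e0 c0 : 0 < e / (`|c| + 1)).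
have [N' vN] := vm _ (divr_gt0 e0 c0 : 0 < e / (`|c| + 1)).
exists (maxn N N') => n; rewrite geq_max => /andP[/uN un /vN vn].
rewrite opprD addrACA -scalerBr (le_trans (ler_normD _ _))// normrZ.
apply: le_trans (lerD (ler_wpM2l (normr_ge0 c) un) vn) _.
by rewrite -{2}[e / _]mul1r -mulrDl mulrC divfK// gt_eqF.
Qed.

Lemma seq_lim_unique (V : normedModType R[i]) (u : nat -> V) l m :
  seq_lim u l -> seq_lim u m -> l = m.
Proof.
move=> ul um; apply/eqP; rewrite -subr_eq0 -normr_le0; apply/ler_addgt0Pr => e e0.
rewrite add0r; have [N uN] := ul _ e0; apply: (seq_lim_dist (N := N) um) => n /uN.
by rewrite distrC; exact.
Qed.

Lemma completeType_seq_complete (E : completeNormedModType R[i]) : seq_complete E.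
Proof.
move=> u cu; have cvu : cvgn u.
  apply: cauchy_cvg; apply: cauchy_exP => e e0.
  have [N uN] := cu _ (divr_gt0 e0 (ltr0Sn _ 1)).
  exists (u N), N => // n /= Nn; rewrite -ball_normE /=.
  by apply: le_lt_trans (uN _ _ (leqnn _) Nn) _; rewrite ltr_pdivrMr// ltr_pMr// ltr1n.
exists (limn u) => e e0; have /cvgrPdist_le/(_ _ e0)[N _ uN] := cvu.
by exists N => n /uN; rewrite distrC.
Qed.

(** The limit is taken pointwise; the Cauchy estimate does not depend on the point, so convergence
    is uniform. The second assumption says that [S] is closed under uniform limits. *)
Lemma supfun_seq_complete T (V : normedModType R[i]) (S : fspace T V) :
  seq_complete V ->
  (forall l : T -> V, (forall e : R[i], 0 < e ->
     exists f : supfun S, forall x, `|f x - l x| <= e) -> l \in fs_pred S) ->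
  seq_complete (supfun S).
Proof.
move=> cV clS u cu.
have uM x m n : `|u m x - u n x| <= `|u m - u n| by exact: (fsnorm_ub (u m - u n)).
have /choice[l ul] x : exists l, seq_lim (u ^~ x) l.
  apply: cV => e /cu[N uN]; exists N => m n Nm Nn.
  exact: le_trans (uM _ _ _) (uN _ _ Nm Nn).
have ule e : 0 < e -> exists N, forall n, (N <= n)%N -> forall x, `|u n x - l x| <= e.
  move=> /cu[N uN]; exists N => n Nn x; apply: (seq_lim_dist (N := N) (ul x)) => m Nm.
  exact: le_trans (uM _ _ _) (uN _ _ Nn Nm).
have lS : l \in fs_pred S.
  by apply: clS => e /ule[N uN]; exists (u N); exact: uN.
exists (SupFun lS) => e e0; have [N uN] := ule _ e0; exists N => n Nn.
by apply: fsnorm_le => [|x]; [exact: ltW|exact: uN].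
Qed.

(** The pointwise limit is approached at rate [e * |x|], which gives both its boundedness and
    convergence in operator norm. *)
Lemma bop_seq_complete (V W : normedModType R[i]) :
  seq_complete W -> seq_complete (bop V W).
Proof.
move=> cW u cu.
have uM x m n : `|u m x - u n x| <= `|u m - u n| * `|x|.
  exact: (bopnorm_ub (u m - u n)).
have /choice[l ul] x : exists l, seq_lim (u ^~ x) l.
  apply: cW => e e0; have x0 : 0 < `|x| + 1 by rewrite ltr_wpDl.
  have [N uN] := cu _ (divr_gt0 e0 x0); exists N => m n Nm Nn.
  apply: le_trans (uM _ _ _) _.
  apply: le_trans (ler_wpM2r (normr_ge0 x) (uN _ _ Nm Nn)) _.
  by rewrite mulrAC ler_pdivrMr// ler_wpM2l ?(ltW e0)// lerDl.
have ule e : 0 < e -> exists N, forall n, (N <= n)%N ->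
    forall x, `|u n x - l x| <= e * `|x|.
  move=> /cu[N uN]; exists N => n Nn x; apply: (seq_lim_dist (N := N) (ul x)) => m Nm.
  by apply: le_trans (uM _ _ _) _; rewrite ler_wpM2r ?uN.
have lB : l \in @bop_pred R V W.
  have [N /(_ _ (leqnn N)) uN] := ule _ ltr01.
  apply: (@bop_mk R _ _ _ (1 + `|u N|)) => [c x y|x].
    have := seq_lim_linear c (ul x) (ul y); apply: seq_lim_unique.
    by move=> e /(ul (c *: x + y))[N' uN']; exists N' => n /uN'; rewrite linearP.
  rewrite -[l x](subrK (u N x)) (le_trans (ler_normD _ _))// mulrDl.
  by rewrite distrC lerD ?uN ?bopnorm_ub.
exists (Bop lB) => e e0; have [N uN] := ule _ e0; exists N => n Nn.
apply: supnorm_le => [|x /= x1]; first exact: ltW.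
by apply: le_trans (uN _ Nn x) _; rewrite ler_piMr// ltW.
Qed.

Lemma Cb_seq_complete (X : topologicalType) (B : normedModType R[i]) :
  seq_complete B -> seq_complete (Cb X B).
Proof.
move=> cB; apply: supfun_seq_complete => // l lS; apply/asboolP; split.
  move=> x; apply/cvgrPdist_le => e e0.
  have e3 : 0 < e / 3 by rewrite divr_gt0.
  have [f fl] := lS _ e3.
  have /asboolP[/(_ x)/cvgrPdist_le/(_ _ e3) cf _] := Defs.fsvalP f.
  near=> y; have -> : l x - l y = (l x - f x) + (f x - f y) + (f y - l y).
    by rewrite !subrKA.
  apply: le_trans (ler_normD _ _) _; apply: le_trans (lerD (ler_normD _ _) (lexx _)) _.
  have -> : e = e / 3 + e / 3 + e / 3.
    by rewrite -!mulrDl -!mulr2n -mulrSr -(mulr_natr e) mulfK.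
  rewrite !lerD//; first by rewrite distrC.
  by near: y.
have [f fl] := lS _ ltr01; exists (1 + `|f|) => x.
rewrite -[l x](subrK (f x)) (le_trans (ler_normD _ _))//.
by rewrite distrC lerD ?fl ?fsnorm_ub.
Unshelve. all: by end_near. Qed.

Lemma linfty_seq_complete (G : choiceType) (B : normedModType R[i]) :
  seq_complete B -> seq_complete (supfun (linfty_space G B)).
Proof.
move=> cB; apply: supfun_seq_complete => // l lS; apply/asboolP.
have [f fl] := lS _ ltr01; exists (1 + `|f|) => x.
rewrite -[l x](subrK (f x)) (le_trans (ler_normD _ _))//.
by rewrite distrC lerD ?fl ?fsnorm_ub.
Qed.

Lemma l0_seq_complete (G : choiceType) (B : normedModType R[i]) :
  seq_complete B -> seq_complete (supfun (l0_space G B)).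
Proof.
move=> cB; apply: supfun_seq_complete => // l lS; apply/asboolP => e e0.
have e2 : 0 < e / 2 by rewrite divr_gt0.
have [f fl] := lS _ e2; have /asboolP/(_ _ e2)[F fF] := Defs.fsvalP f.
exists F => g gF; rewrite -[l g](subrK (f g)) (le_lt_trans (ler_normD _ _))//.
by rewrite distrC [e]splitr ler_ltD ?fl ?fF.
Qed.

End Completeness.

Lemma bop_normM {R : realType} {V : normedModType R[i]} (P Q : bop V V) :
  `|P * Q| <= `|P| * `|Q|.
Proof.
apply: supnorm_le => [|x /= x1]; first exact: mulr_ge0.
apply: le_trans (bopnorm_ub _ _) _; rewrite ler_wpM2l//.
by apply: le_trans (bopnorm_ub _ _) _; rewrite ler_piMr.
Qed.

(** * Extension of an isometric relation to closures *)

Section GraphClosure.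
Context {R : realType}.

(** Membership of [(P, Q)] in the closure of the graph of [r]. A relation is used because an
    operator can be written as a finite sum in several ways, so that well-definedness is only a
    consequence of the norm equality. *)
Definition graph_closure (V W : normedModType R[i]) (r : V -> W -> Prop) P Q :=
  forall e : R[i], 0 < e ->
    exists P' Q', [/\ r P' Q', `|P - P'| <= e & `|Q - Q'| <= e].

Lemma graph_closure_sym (V W : normedModType R[i]) (r : V -> W -> Prop) P Q :
  graph_closure r P Q -> graph_closure (fun Q P => r P Q) Q P.
Proof. by move=> rPQ e /rPQ[P' [Q' []]]; exists Q', P'. Qed.

Lemma graph_closure_sub (V W : normedModType R[i]) (r : V -> W -> Prop) P Q :
  r P Q -> graph_closure r P Q.
Proof. by move=> rPQ e e0; exists P, Q; rewrite !subrr !normr0 ltW. Qed.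

Lemma graph_closure_dom (V W : normedModType R[i]) (r : V -> W -> Prop) P Q :
  graph_closure r P Q -> closure [set P | exists Q, r P Q] P.
Proof.
move=> rPQ B /nbhs_normP[e /= e0 eB].
have [P' [Q' [rPQ' PP' _]]] := rPQ _ (divr_gt0 e0 (ltr0Sn _ 1)).
exists P'; split; first by exists Q'.
apply: eB; rewrite /= (le_lt_trans PP')// ltr_pdivrMr// ltr_pMr//.
by rewrite ltr1n.
Qed.

Lemma graph_closure_le (V W : normedModType R[i]) (r : V -> W -> Prop) :
  (forall P Q, r P Q -> `|Q| = `|P|) ->
  forall P Q, graph_closure r P Q -> `|Q| <= `|P|.
Proof.
move=> riso P Q rPQ; apply/ler_addgt0Pr => e e0.
have [P' [Q' [/riso rPQ' PP' QQ']]] := rPQ _ (divr_gt0 e0 (ltr0Sn _ 1)).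
rewrite -[Q](subrK Q') (le_trans (ler_normD _ _))// rPQ'.
rewrite -[P'](subrK P) addrC; apply: le_trans (lerD (ler_normD _ _) QQ') _.
by rewrite [in leRHS](splitr e) [leRHS]addrA [ `|P| + _]addrC !lerD// distrC.
Qed.

Lemma graph_closure_linear (V W : normedModType R[i]) (r : V -> W -> Prop) :
  (forall c P Q P' Q', r P Q -> r P' Q' -> r (c *: P + P') (c *: Q + Q')) ->
  forall c P Q P' Q', graph_closure r P Q -> graph_closure r P' Q' ->
    graph_closure r (c *: P + P') (c *: Q + Q').
Proof.
move=> rlin c P Q P' Q' rPQ rPQ' e e0.
have c0 : 0 < `|c| + 1 by rewrite ltr_wpDl.
have ce0 : 0 < e / (`|c| + 1) by rewrite divr_gt0.
have [P1 [Q1 [r1 PP1 QQ1]]] := rPQ _ ce0; have [P2 [Q2 [r2 PP2 QQ2]]] := rPQ' _ ce0.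
have le_e (U : normedModType R[i]) (A B A' B' : U) : `|A - A'| <= e / (`|c| + 1) ->
    `|B - B'| <= e / (`|c| + 1) -> `|c *: A + B - (c *: A' + B')| <= e.
  move=> AA' BB'; rewrite opprD addrACA -scalerBr (le_trans (ler_normD _ _))// normrZ.
  apply: le_trans (lerD (ler_wpM2l (normr_ge0 c) AA') BB') _.
  by rewrite -{2}[e / _]mul1r -mulrDl mulrC divfK// gt_eqF.
by exists (c *: P1 + P2), (c *: Q1 + Q2); split; [exact: rlin|exact: le_e|exact: le_e].
Qed.

Lemma graph_closure_mul (V W : normedModType R[i]) (r : L(V) -> L(W) -> Prop) :
  (forall P Q P' Q', r P Q -> r P' Q' -> r (P * P') (Q * Q')) ->
  forall P Q P' Q', graph_closure r P Q -> graph_closure r P' Q' ->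
    graph_closure r (P * P') (Q * Q').
Proof.
move=> rmul P Q P' Q' rPQ rPQ' e e0.
(* [K] serves the products in [V] and in [W] at once; its summand [e] makes [e / K <= 1], and its
   summand 1 absorbs the resulting bound [|B'| <= |B| + 1]. *)
pose K := `|P| + `|P'| + (`|Q| + `|Q'|) + 1 + e.
have K0 : 0 < K by rewrite ltr_wpDl// ?addr_ge0.
have d0 : 0 < e / K by rewrite divr_gt0.
have d1 : e / K <= 1 by rewrite ler_pdivrMr// mul1r lerDr ?addr_ge0.
have [P1 [Q1 [r1 PP1 QQ1]]] := rPQ _ d0; have [P2 [Q2 [r2 PP2 QQ2]]] := rPQ' _ d0.
have le_e (U : normedModType R[i]) (A B A' B' : L(U)) :
    `|A| + `|B| <= `|P| + `|P'| + (`|Q| + `|Q'|) ->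
    `|A - A'| <= e / K -> `|B - B'| <= e / K -> `|A * B - A' * B'| <= e.
  move=> ABK AA' BB'; have -> : A * B - A' * B' = A * (B - B') + (A - A') * B'.
    by rewrite mulrBr mulrBl subrKA.
  have B'le : `|B'| <= `|B| + 1.
    rewrite -[B'](subrK B) addrC (le_trans (ler_normD _ _))// lerD2l distrC.
    exact: le_trans BB' d1.
  apply: le_trans (ler_normD _ _) _.
  apply: (@le_trans _ _ (`|A| * (e / K) + (e / K) * (`|B| + 1))).
    apply: lerD; apply: le_trans (bop_normM _ _) _; first by rewrite ler_wpM2l.
    by rewrite ler_pM.
  rewrite [ `|A| * _]mulrC -mulrDr mulrAC ler_pdivrMr// ler_wpM2l ?(ltW e0)//.
  by rewrite addrA (le_trans (lerD ABK (lexx 1)))// lerDl ltW.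
exists (P1 * P2), (Q1 * Q2); split; first exact: rmul.
  by apply: le_e => //; rewrite lerDl addr_ge0.
by apply: le_e => //; rewrite lerDr addr_ge0.
Qed.

(** By linearity and isometry, partners of approximants of [P] are as close to each other as the
    approximants, hence form a Cauchy sequence; its limit is the partner of [P]. *)
Lemma graph_closure_total (V W : normedModType R[i]) (r : V -> W -> Prop) :
  seq_complete W ->
  (forall c P Q P' Q', r P Q -> r P' Q' -> r (c *: P + P') (c *: Q + Q')) ->
  (forall P Q, r P Q -> `|Q| = `|P|) ->
  forall P, closure [set P | exists Q, r P Q] P -> exists Q, graph_closure r P Q.
Proof.
move=> cW rlin riso P clP.
pose d n : R[i] := n.+1%:R^-1.
have dlt e : 0 < e -> exists N, forall n, (N <= n)%N -> d n <= e.
  (* A positive [e] in [R[i]] equals its real part, to which the Archimedean property applies; the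
     successor in [d n] makes up for the truncation. *)
  move=> e0; exists (Num.trunc (complex.Re e)^-1) => n Nn.
  have eE : e = real_complex R (complex.Re e).
    by move: e0; rewrite ltcE /= => /andP[/eqP]; case: (e) => a b /= ->.
  have Re0 : 0 < complex.Re e by move: e0; rewrite eE ltcR.
  rewrite /d invf_ple ?posrE ?ltr0Sn// eE -fmorphV -(rmorph_nat (real_complex R)) lecR.
  apply: ltW; apply: lt_le_trans (truncnS_gt _) _.
  by rewrite ler_nat.
have /choice[u ru] n : exists u : V * W, r u.1 u.2 /\ `|P - u.1| <= d n.
  have [|P' [[Q' rPQ'] PP']] := clP (ball P (d n)).
    by apply: nbhsx_ballx; rewrite invr_gt0 ltr0Sn.
  by exists (P', Q'); split => //; move: PP'; rewrite -ball_normE /= => /ltW.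
have [|Q uQ] := cW (fun n => (u n).2).
  move=> e e0; have [N dN] := dlt _ (divr_gt0 e0 (ltr0Sn _ 1)).
  exists N => m n Nm Nn; have -> : (u m).2 - (u n).2 = (-1) *: (u n).2 + (u m).2.
    by rewrite scaleN1r addrC.
  rewrite (riso _ _ (rlin (-1) _ _ _ _ (ru n).1 (ru m).1)) scaleN1r addrC.
  rewrite -(subrKA P) (le_trans (ler_normD _ _))// [e]splitr lerD//.
    by rewrite distrC (le_trans (ru m).2)// dN.
  by rewrite (le_trans (ru n).2)// dN.
exists Q => e e0; have [N dN] := dlt _ e0; have [N' uN'] := uQ _ e0.
pose n := maxn N N'; exists (u n).1, (u n).2; split; first exact: (ru n).1.
  by rewrite (le_trans (ru n).2)// dN// leq_maxl.
by rewrite distrC uN'// leq_maxr.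
Qed.

(** The closed graph is the graph of a bijection: two partners of one operator differ by a partner
    of 0, which has norm 0. Existence of partners on either side comes from completeness. *)
Lemma closure_isom (V W : normedModType R[i]) (r : L(V) -> L(W) -> Prop) :
  seq_complete V -> seq_complete W ->
  (forall c P Q P' Q', r P Q -> r P' Q' -> r (c *: P + P') (c *: Q + Q')) ->
  (forall P Q P' Q', r P Q -> r P' Q' -> r (P * P') (Q * Q')) ->
  (forall P Q, r P Q -> `|Q| = `|P|) ->
  exists Phi, banach_algebra_isom (closure [set P | exists Q, r P Q])
      (closure [set Q | exists P, r P Q]) Phi /\
    forall P Q, r P Q -> Phi P = Q.
Proof.
move=> cV cW rlin rmul riso; pose r' Q P := r P Q.
have r'lin c Q P Q' P' : r' Q P -> r' Q' P' -> r' (c *: Q + Q') (c *: P + P').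
  exact: rlin.
have r'iso Q P : r' Q P -> `|P| = `|Q| by move=> /riso.
have rnorm P Q : graph_closure r P Q -> `|Q| = `|P|.
  move=> rPQ; apply/eqP; rewrite eq_le (graph_closure_le riso rPQ) /=.
  exact: graph_closure_le r'iso _ _ (graph_closure_sym rPQ).
have rlinC := graph_closure_linear rlin.
have rfun P Q Q' : graph_closure r P Q -> graph_closure r P Q' -> Q = Q'.
  move=> rPQ rPQ'; have := rnorm _ _ (rlinC (-1) _ _ _ _ rPQ' rPQ).
  by rewrite !scaleN1r addNr normr0 => /normr0_eq0/eqP; rewrite addrC subr_eq0 => /eqP.
have rinj P P' Q : graph_closure r P Q -> graph_closure r P' Q -> P = P'.
  move=> rPQ rPQ'; have := rnorm _ _ (rlinC (-1) _ _ _ _ rPQ' rPQ).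
  rewrite !scaleN1r addNr normr0 => /esym/normr0_eq0/eqP.
  by rewrite addrC subr_eq0 => /eqP.
have rtot := graph_closure_total (bop_seq_complete cW) rlin riso.
have rsurj := graph_closure_total (bop_seq_complete cV) r'lin r'iso.
have [Phi PhiP] : exists Phi, forall P Q, graph_closure r P Q -> Phi P = Q.
  (* The default value 0 is taken only outside the domain of the closed graph. *)
  exists (fun P => xget 0 [set Q | graph_closure r P Q]) => P Q rPQ.
  by case: xgetP => [Q' _|/(_ Q)] //= rPQ'; exact: rfun rPQ' rPQ.
exists Phi; split; last by move=> P Q /graph_closure_sub/PhiP.
split; first split.
- move=> P /rtot[Q rPQ]; rewrite (PhiP _ _ rPQ).
  exact: graph_closure_dom (graph_closure_sym rPQ).
- move=> P P' /set_mem/rtot[Q rPQ] /set_mem/rtot[Q' rPQ'].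
  rewrite (PhiP _ _ rPQ) (PhiP _ _ rPQ') => QQ'; subst Q'.
  exact: rinj rPQ rPQ'.
- move=> Q /rsurj[P /graph_closure_sym rPQ]; exists P; last exact: PhiP.
  exact: graph_closure_dom rPQ.
- move=> c P P' /rtot[Q rPQ] /rtot[Q' rPQ'].
  by rewrite (PhiP _ _ rPQ) (PhiP _ _ rPQ'); exact: PhiP (rlinC c _ _ _ _ rPQ rPQ').
- move=> P P' /rtot[Q rPQ] /rtot[Q' rPQ'].
  by rewrite (PhiP _ _ rPQ) (PhiP _ _ rPQ'); exact: PhiP (graph_closure_mul rmul rPQ rPQ').
- by move=> P /rtot[Q rPQ]; rewrite (PhiP _ _ rPQ) (rnorm _ _ rPQ).
Qed.

End GraphClosure.

(** * Interpolation by continuous functions and density of points with free orbit segments *)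

Section ContinuousFunctions.
Context {R : realType} {X : topologicalType}.

Lemma real_complex_cvg T (F : set_system T) (FF : Filter F) (d : T -> R) (l : R) :
  d x @[x --> F] --> l ->
  (real_complex R (d x) : (R[i] : numFieldType)) @[x --> F] -->
  (real_complex R l : (R[i] : numFieldType)).
Proof.
move=> /cvgrPdist_le dl; apply/cvgrPdist_le => e e0.
have eE : e = real_complex R (complex.Re e).
  by move: e0; rewrite ltcE /= => /andP[/eqP]; case: (e) => a b /= ->.
have Re0 : 0 < complex.Re e by move: e0; rewrite eE ltcR.
apply: filterS (dl _ Re0) => x dx.
by rewrite -rmorphB /= normc_def /= expr0n addr0 sqrtr_sqr eE lecR.
Qed.

Lemma cst_Cb_subproof (B : normedModType R[i]) (b : B) : (fun _ => b) \in @Cb_pred R X B.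
Proof. by apply/asboolP; split; [exact: cst_continuous|exists `|b|]. Qed.

Definition cst_Cb (B : normedModType R[i]) (b : B) : Cb X B :=
  @SupFun _ _ _ (Cb_space X B) _ (cst_Cb_subproof b).

Lemma mulop_Cb_subproof (V : normedModType R[i]) (a b : Cb X L(V)) :
  (fun x => a x * b x) \in @Cb_pred R X L(V).
Proof.
have /asboolP[ca _] := Defs.fsvalP a; have /asboolP[cb _] := Defs.fsvalP b.
apply/asboolP; split; last first.
  exists (`|a| * `|b|) => x; apply: le_trans (bop_normM _ _) _.
  by rewrite ler_pM ?fsnorm_ub.
move=> x; apply/cvgrPdist_le => e e0.
have N0 : 0 < `|a| + `|b| + 1 by rewrite ltr_wpDl// addr_ge0.
have d0 : 0 < e / (`|a| + `|b| + 1) by rewrite divr_gt0.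
have /cvgrPdist_le/(_ _ d0) ha := ca x; have /cvgrPdist_le/(_ _ d0) hb := cb x.
near=> y.
have -> : a x * b x - a y * b y = a x * (b x - b y) + (a x - a y) * b y.
  by rewrite mulrBr mulrBl subrKA.
apply: le_trans (ler_normD _ _) _.
apply: (@le_trans _ _ ((`|a| + `|b|) * (e / (`|a| + `|b| + 1)))).
  rewrite [leRHS]mulrDl; apply: lerD.
    by apply: le_trans (bop_normM _ _) _; rewrite ler_pM ?fsnorm_ub//; near: y.
  apply: le_trans (bop_normM _ _) _; rewrite mulrC ler_pM ?fsnorm_ub//.
  by near: y.
rewrite mulrA ler_pdivrMr// mulrC ler_wpM2l ?(ltW e0)// lerDl//.
Unshelve. all: by end_near. Qed.

Definition mulop_Cb (V : normedModType R[i]) (a b : Cb X L(V)) : Cb X L(V) :=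
  @SupFun _ _ _ (Cb_space X L(V)) _ (mulop_Cb_subproof a b).

(* Convex combinations keep the norm bounded by M, so no disjointness of the
   supports of the separating functions is needed. *)
Lemma Cb_interpolation (B : normedModType R[i]) (I : eqType) (s : seq I)
    (z : I -> X) (b : I -> B) (M : R[i]) :
  hausdorff_space X -> completely_regular_space X -> 0 <= M ->
  {in s &, injective z} -> (forall i, i \in s -> `|b i| <= M) ->
  exists f : Cb X B, (forall x, `|f x| <= M) /\ forall i, i \in s -> f (z i) = b i.
Proof.
move=> hX crX M0; elim: s => [_ _|i s IH zI bM].
  by exists 0; split => // x; rewrite normr0.
have [||f [fM fz]] := IH.
- by move=> j k js ks; apply: zI; rewrite inE ?js ?ks orbT.
- by move=> j js; apply: bM; rewrite inE js orbT.
(* The list may repeat an index, in which case the function for the tail already fits. *)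
have [is_|is_] := boolP (i \in s).
  by exists f; split => // j; rewrite inE => /predU1P[->|]; exact: fz.
have clS : closed [set` [seq z j | j <- s]].
  apply: (accessible_finite_set_closed.1 (hausdorff_accessible hX)).
  exact: finite_seq.
have nSi : ~ [set` [seq z j | j <- s]] (z i).
  move=> /= /mapP[j js /zI ij]; move: is_; rewrite ij ?js// inE ?eqxx// js orbT.
  by [].
(* [d] is 0 at the new point and 1 at all the others, so blending with weight [d] changes only the
   value that still has to be prescribed. *)
have /(uniform_separatorP (R := R))[d [cd d01 di ds]] := crX _ _ clS nSi.
have /all_and2[d0 d1] x : 0 <= d x /\ d x <= 1.
  by have := d01 _ (imageT d x); rewrite /= in_itv /= => /andP.
pose D := real_complex R.
pose h x := D (d x) *: f x + D (1 - d x) *: b i.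
have hM x : `|h x| <= M.
  rewrite (le_trans (ler_normD _ _))// !normrZ !ger0_norm ?lecR ?subr_ge0//.
  have -> : M = D (d x) * M + D (1 - d x) * M by rewrite -mulrDl -rmorphD subrKC mul1r.
  rewrite lerD ?ler_wpM2l ?lecR ?subr_ge0 ?bM ?inE ?eqxx//.
have hP : h \in @Cb_pred R X B.
  apply/asboolP; split; last by exists M.
  have /asboolP[cf _] := Defs.fsvalP f.
  move=> x; apply: cvgD; first by apply: cvgZ (cf x); apply: real_complex_cvg; exact: cd.
  apply: cvgZr_tmp; apply: real_complex_cvg; apply: cvgB; first exact: cvg_cst.
  exact: cd.
exists (@SupFun _ _ _ (Cb_space X B) _ hP); split => //= j.
rewrite inE /h => /predU1P[->|js].
  have -> : d (z i) = 0 by apply: di; exists (z i).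
  by rewrite subr0 /D rmorph0 rmorph1 scale0r add0r scale1r.
have -> : d (z j) = 1 by apply: ds; exists (z j) => //=; exact: map_f.
by rewrite subrr /D rmorph0 rmorph1 scale0r addr0 scale1r fz.
Qed.

(** The points moved by a given [g] form an open set, as [X] is Hausdorff, and a dense one, by
    freeness; a finite intersection of such sets still meets [W]. *)
Lemma topologically_free_dense (G : groupType) (t : homeo_action G X) (s : seq G)
    (W : set X) :
  hausdorff_space X -> topologically_free t -> (forall g, g \in s -> g != 1%g) ->
  open W -> W !=set0 -> exists2 x, W x & forall g, g \in s -> t g x <> x.
Proof.
move=> hX ft; elim: s W => [|g s IH] W s1 oW W0; first by case: W0 => x Wx; exists x.
have oN : open [set x | t g x <> x].
  rewrite openE => x /= /eqP tx; have [[A B] /= [xA xB] [oA oB AB0]] : exists2 AB,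
      t g x \in AB.1 /\ x \in AB.2 & [/\ open AB.1, open AB.2 & AB.1 `&` AB.2 == set0].
    by move: hX; rewrite open_hausdorff => /(_ _ _ tx)[AB [? ?] ?]; exists AB.
  have nA : \forall y \near x, A (t g y).
    apply: (@act_continuous _ _ t g x); apply: open_nbhs_nbhs; split => //.
    exact: set_mem.
  have nB : \forall y \near x, B y by apply: open_nbhs_nbhs; split => //; exact: set_mem.
  apply: filterS2 nA nB => y Ay By ty; move/eqP: AB0; rewrite -subset0 => /(_ y).
  by apply; split => //; rewrite -{1}ty.
have [|||x [Wx tx] xs] := IH (W `&` [set x | t g x <> x]).
- by move=> h hs; apply: s1; rewrite inE hs orbT.
- exact: openI.
(* Otherwise [g] fixes all of [W], a nonempty open set inside a set with empty interior. *)
- apply: contrapT => N; case: W0 => x Wx.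
  suff: interior [set x | t g x = x] x by rewrite ft ?s1 ?inE ?eqxx.
  suff: W `<=` interior [set x | t g x = x] by exact.
  rewrite -open_subsetE// => y Wy; apply: contrapT => ty; apply: N; exists y.
  by split.
by exists x => // h; rewrite inE => /predU1P[->|/xs].
Qed.

End ContinuousFunctions.

(** * Finite sums of operators: collecting terms and evaluation *)

Lemma op_sum_fset {R : realType} {V : normedModType R[i]} {G : groupType}
    (A : set L(V)) (U : G -> L(V)) (I : eqType) (s : seq I) (a : I -> L(V)) (g : I -> G) :
  A 0 -> (forall P Q, A P -> A Q -> A (P + Q)) -> (forall i, A (a i)) ->
  exists (F : {fset G}) (b : G -> L(V)),
    (forall h, A (b h)) /\ \sum_(i <- s) a i * U (g i) = \sum_(h <- F) b h * U h.
Proof.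
move=> A0 AD Aa; exists [fset h in [seq g i | i <- s]]%fset.
exists (fun h => \sum_(i <- s | g i == h) a i); split.
  by move=> h; apply: big_ind.
under [RHS]eq_bigr do rewrite mulr_suml.
rewrite (exchange_big_dep xpredT)//= big_seq [RHS]big_seq; apply: eq_bigr => i si.
under eq_bigl do rewrite eq_sym.
rewrite -big_filter filter_pred1_uniq ?fset_uniq ?big_seq1 ?inE ?map_f//.
Qed.

Lemma bop_scaleE {R : realType} (V W : normedModType R[i]) (c : R[i]) (P : bop V W) f :
  (c *: P) f = c *: P f.
Proof. by []. Qed.

Lemma bop_addE {R : realType} (V W : normedModType R[i]) (P Q : bop V W) f :
  (P + Q) f = P f + Q f.
Proof. by []. Qed.

Lemma bop_mulZl {R : realType} (V : normedModType R[i]) (c : R[i]) (P Q : L(V)) :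
  c *: P * Q = c *: (P * Q).
Proof. exact: bop_ext. Qed.

Lemma supfun_scaleE {R : realType} T (V : normedModType R[i]) (S : fspace T V) (c : R[i])
    (f : supfun S) x : (c *: f) x = c *: f x.
Proof. by []. Qed.

Lemma supfun_addE {R : realType} T (V : normedModType R[i]) (S : fspace T V)
    (f g : supfun S) x : (f + g) x = f x + g x.
Proof. by []. Qed.

Lemma bop_sumE {R : realType} (V W : normedModType R[i]) I (s : seq I)
    (P : I -> bop V W) f :
  (\sum_(i <- s) P i) f = \sum_(i <- s) P i f.
Proof. by elim: s => [|i s IH]; rewrite ?big_nil// !big_cons -IH. Qed.

Lemma supfun_sumE {R : realType} T (V : normedModType R[i]) (S : fspace T V) I (s : seq I)
    (f : I -> supfun S) x : (\sum_(i <- s) f i) x = \sum_(i <- s) f i x.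
Proof. by elim: s => [|i s IH]; rewrite ?big_nil// !big_cons -IH. Qed.

(** * Equality of norms of corresponding finite sums, and the isomorphism *)

Section RegularRepresentation.
Context {R : realType} {X : topologicalType} {E : normedModType R[i]}.
Context {G : groupType} (t : homeo_action G X) (H : regspace (E := E) t).
Local Notation D := (Cb X E).

(* The list may repeat a group element, so that sums and products of operators are
   again of this form without collecting terms. *)
Definition wsum (s : seq (Cb X L(E) * G)) : L(D) :=
  \sum_(p <- s) mulop p.1 * shiftop t p.2.

Definition rsum (s : seq (Cb X L(E) * G)) : L(supfun H) :=
  \sum_(p <- s) regbar H (mulop p.1) * regV H p.2.

Lemma wsumE s (f : D) x : wsum s f x = \sum_(p <- s) p.1 x (f (t p.2^-1%g x)).
Proof. by rewrite /wsum bop_sumE supfun_sumE. Qed.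

(** All coefficients are evaluated at the single point t_g^{-1}(x), while the vectors are values of
    [xi] at different group elements, hence unrelated to each other. *)
Lemma rsumE s (xi : supfun H) g x :
  rsum s xi g x = \sum_(p <- s) p.1 (t g^-1%g x) (xi (g * p.2)%g x).
Proof.
rewrite /rsum bop_sumE !supfun_sumE; apply: eq_bigr => p _.
exact: (shiftconj_mulop t g p.1 x (xi (g * p.2)%g)).
Qed.

Definition wscale (c : R[i]) (s : seq (Cb X L(E) * G)) := [seq (c *: p.1, p.2) | p <- s].

(** Encodes a T_g b T_h = a \hat T_g(b) T_{gh}; here [shiftfun] acts on functions with values in
    [L(E)]. *)
Definition wmul (s s' : seq (Cb X L(E) * G)) :=
  [seq (mulop_Cb p.1 (shiftfun t p.2 q.1), (p.2 * q.2)%g) | p <- s, q <- s'].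

Lemma mulopZ c (a : Cb X L(E)) : mulop (c *: a) = c *: mulop a.
Proof.
apply: bop_ext => f; apply: fsP => x.
transitivity ((c *: a) x (f x)); first by [].
by rewrite [RHS]supfun_scaleE (supfun_scaleE c a) bop_scaleE.
Qed.

Lemma mulopD (a b : Cb X L(E)) : mulop (a + b) = mulop a + mulop b.
Proof.
apply: bop_ext => f; apply: fsP => x.
transitivity ((a + b) x (f x)); first by [].
by rewrite [RHS]supfun_addE (supfun_addE a) bop_addE.
Qed.

Lemma regbarE b (xi : supfun H) g :
  regbar H b xi g = shiftop t g (b (shiftop t g^-1%g (xi g))).
Proof. by []. Qed.

Lemma regbarZ c b : regbar H (c *: b) = c *: regbar H b.
Proof.
apply: bop_ext => xi; apply: fsP => g.
by rewrite bop_scaleE supfun_scaleE !regbarE bop_scaleE linearZ.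
Qed.

Lemma regbarD a b : regbar H (a + b) = regbar H a + regbar H b.
Proof.
apply: bop_ext => xi; apply: fsP => g.
by rewrite bop_addE supfun_addE !regbarE bop_addE linearD.
Qed.

Lemma wsum_linear c s s' : wsum (wscale c s ++ s') = c *: wsum s + wsum s'.
Proof.
rewrite /wsum big_cat big_map scaler_sumr.
by under eq_bigr do rewrite mulopZ bop_mulZl.
Qed.

Lemma rsum_linear c s s' : rsum (wscale c s ++ s') = c *: rsum s + rsum s'.
Proof.
rewrite /rsum big_cat big_map scaler_sumr.
by under eq_bigr do rewrite mulopZ regbarZ bop_mulZl.
Qed.

Lemma wsum_mul s s' : wsum (wmul s s') = wsum s * wsum s'.
Proof.
rewrite /wsum big_allpairs_dep mulr_suml; apply: eq_bigr => p _.
rewrite mulr_sumr; apply: eq_bigr => q _.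
by apply: bop_ext => f; apply: fsP => x /=; rewrite invgM actM.
Qed.

(** The regular representation obeys the same commutation rule: V_g followed by evaluation at k
    turns \bar b into \hat T_{kg}(b) = \hat T_k(\hat T_g(b)). *)
Lemma rsum_mul s s' : rsum (wmul s s') = rsum s * rsum s'.
Proof.
rewrite /rsum big_allpairs_dep mulr_suml; apply: eq_bigr => p _.
rewrite mulr_sumr; apply: eq_bigr => q _.
apply: bop_ext => f; apply: fsP => g; apply: fsP => x /=.
by rewrite -!actM !invgM !invgK !mulgA !mulgK !mulgV !act1.
Qed.

Hypothesis l0H : forall xi, xi \in l0_space G D -> xi \in rs_space H.

(* Restricting the orbit of f at x to finitely many group elements gives a
   finitely supported vector of H, on which rsum s acts as wsum s does on f. *)
Lemma wsum_le_rsum s : `|wsum s| <= `|rsum s|.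
Proof.
apply: supnorm_le => // f /= f1; apply: fsnorm_le => // x.
pose F := [fset g in [seq p.2 | p <- s]]%fset.
(* Only values at [x] will matter, so constant functions suffice, and they keep the norm at most
   [|f|]. *)
pose xi (g : G) : D := if g \in F then cst_Cb (f (t g^-1%g x)) else 0.
have xiH : xi \in rs_space H.
  by apply: l0H; apply/asboolP => e e0; exists F => g /negPf gF; rewrite /xi gF normr0.
have xi1 : `|SupFun xiH| <= 1.
  apply: fsnorm_le => // g; rewrite /= /xi; case: ifP => _; last by rewrite normr0.
  by apply: fsnorm_le => // y; apply: le_trans f1; exact: fsnorm_ub.
have -> : wsum s f x = rsum s (SupFun xiH) 1%g x.
  rewrite wsumE rsumE big_seq [RHS]big_seq; apply: eq_bigr => p ps.
  by rewrite invg1 act1 mul1g /= /xi !inE map_f.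
apply: le_trans (fsnorm_ub _ _) _; apply: le_trans (fsnorm_ub _ _) _.
by apply: le_trans (bopnorm_ub _ _) _; rewrite ler_piMr.
Qed.

Hypothesis hX : hausdorff_space X.
Hypothesis crX : completely_regular_space X.
Hypothesis ft : topologically_free t.

(** Near [y] there is an [x] whose translates t_g^{-1}(x), for the group elements g in [s], are
    distinct. Interpolation gives [f] of norm at most [M] with value [e g] there, and then
    [wsum s f] at [x] is the sum at [x], close to the one at [y]. *)
Lemma wsum_symbol_le (s : seq (Cb X L(E) * G)) (e : G -> E) (M : R[i]) y : 0 <= M ->
  (forall g, `|e g| <= M) -> `|\sum_(p <- s) p.1 y (e p.2)| <= `|wsum s| * M.
Proof.
move=> M0 eM.
(* Applying the coefficients to constant functions makes the sum an element of [D], hence continuous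
   in the point. *)
pose F : D := \sum_(p <- s) mulop p.1 (cst_Cb (e p.2)).
have FE x : F x = \sum_(p <- s) p.1 x (e p.2).
  exact: supfun_sumE.
rewrite -FE; apply/ler_addgt0Pr => eps eps0.
have /asboolP[/(_ y)/cvgrPdist_le/(_ _ eps0) cF _] := Defs.fsvalP F.
pose S := [seq p.2 | p <- s].
(* If t_g^{-1}(x) = t_h^{-1}(x), then h g^{-1} fixes x; so it is enough that no nontrivial quotient
   of elements of [S] fixes x. *)
pose Q := [seq gh <- [seq (g * h^-1)%g | g <- S, h <- S] | gh != 1%g].
have [|||x Fx tx] := topologically_free_dense (s := Q)
  (W := interior [set x | `|F y - F x| <= eps]) hX ft.
- by move=> g; rewrite mem_filter => /andP[].
- exact: open_interior.
- by exists y; exact: cF.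
have zI : {in S &, injective (fun g => t g^-1%g x)}.
  move=> g h gS hS gh; apply/eqP; apply: contrapT => /negP ngh.
  apply: (tx (h * g^-1)%g); last by rewrite actM gh actVK.
  rewrite mem_filter divg_eq1 eq_sym ngh /=.
  by apply/allpairsP; exists (h, g).
have [f [fM fz]] := Cb_interpolation hX crX M0 zI (fun g _ => eM g).
rewrite -[F y](subrK (F x)) addrC (le_trans (ler_normD _ _))//.
rewrite lerD//; last exact: interior_subset Fx.
have -> : F x = wsum s f x.
  rewrite FE wsumE big_seq [RHS]big_seq; apply: eq_bigr => p ps.
  by rewrite fz// map_f.
apply: le_trans (fsnorm_ub _ _) _; apply: le_trans (bopnorm_ub _ _) _.
by rewrite ler_wpM2l//; exact: fsnorm_le.
Qed.

(** Each value of [rsum s xi] is a sum as in [wsum_symbol_le] at y = t_g^{-1}(x), with vectors from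
    the unit ball, so [M = 1]. *)
Lemma rsum_le_wsum s : `|rsum s| <= `|wsum s|.
Proof.
apply: supnorm_le => // xi /= xi1; apply: fsnorm_le => // g; apply: fsnorm_le => // x.
rewrite rsumE -[leRHS]mulr1.
apply: (@wsum_symbol_le s (fun h => xi (g * h)%g x)) => // h.
by apply: le_trans xi1; apply: le_trans (fsnorm_ub _ _) _; exact: fsnorm_ub.
Qed.

Hypothesis cE : seq_complete E.
Hypothesis cH : seq_complete (supfun H).

(** Operators with a common list of coefficients are related; the norm inequalities make this
    relation isometric, and its domain and range have the two algebras as closures. *)
Lemma regular_isom_of_l0_sub : regular_isom H.
Proof.
pose r P Q := exists s, P = wsum s /\ Q = rsum s.
have [|||Phi [isoPhi PhiE]] := @closure_isom R _ _ r (Cb_seq_complete cE) cH.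
- move=> c _ _ _ _ [s [-> ->]] [s' [-> ->]]; exists (wscale c s ++ s').
  by rewrite wsum_linear rsum_linear.
- move=> _ _ _ _ [s [-> ->]] [s' [-> ->]]; exists (wmul s s').
  by rewrite wsum_mul rsum_mul.
- move=> _ _ [s [-> ->]]; apply/eqP.
  by rewrite eq_le wsum_le_rsum rsum_le_wsum.
have mulop0 : mulop (0 : Cb X L(E)) = 0 by rewrite -[0 in LHS](scale0r 0) mulopZ scale0r.
have regbar0 : regbar H 0 = 0 by rewrite -[0 in LHS](scale0r 0) regbarZ scale0r.
have mulop1 : mulop (cst_Cb (1 : L(E))) = (1 : L(D)) by apply: bop_ext => f; apply: fsP.
have regbar1 : regbar H 1 = (1 : L(supfun H)).
  by apply: bop_ext => xi; apply: fsP => g; apply: fsP => x; rewrite /= invgK actVK.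
have regV1 : regV H 1%g = (1 : L(supfun H)).
  by apply: bop_ext => xi; apply: fsP => g /=; rewrite mulg1.
exists Phi; split.
- have -> : op_algebra mulalg (shiftop t) = closure [set P | exists Q, r P Q].
    congr closure; apply/seteqP; split => [_ [F [a [Aa ->]]]|_ [_ [s [-> _]]]].
      have /choice[b ab] g : exists b, mulop b = a g by have [b _] := Aa g; exists b.
      exists (rsum [seq (b g, g) | g <- F]), [seq (b g, g) | g <- F]; split => //.
      by rewrite /wsum big_map; apply: eq_bigr => g _; rewrite ab.
    apply: op_sum_fset => [|P Q [a _ <-] [b _ <-]|p].
    + by exists 0.
    + by rewrite -mulopD; exists (a + b).
    + by exists p.1.
  have -> : op_algebra (regbar H @` mulalg) (regV H) = closure [set Q | exists P, r P Q].
    congr closure; apply/seteqP; split => [_ [F [a [Aa ->]]]|_ [_ [s [_ ->]]]].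
      have /choice[b ab] g : exists b, regbar H (mulop b) = a g.
        by have [_ [b _ <-]] := Aa g; exists b.
      exists (wsum [seq (b g, g) | g <- F]), [seq (b g, g) | g <- F]; split => //.
      by rewrite /rsum big_map; apply: eq_bigr => g _; rewrite ab.
    apply: op_sum_fset => [|P Q [_ [a _ <-] <-] [_ [b _ <-] <-]|p].
    + by exists 0 => //; exists 0.
    + by exists (mulop (a + b)); [exists (a + b)|rewrite mulopD regbarD].
    + by exists (mulop p.1) => //; exists p.1.
  exact: isoPhi.
(* The generators are one-term sums: a is a T_e, and T_g has the constant identity operator as
   coefficient. *)
- move=> _ [a _ <-]; apply: PhiE; exists [:: (a, 1%g)].
  by rewrite /wsum /rsum !big_seq1 shiftop1 regV1 !mulr1.
- move=> g; apply: PhiE; exists [:: (cst_Cb (1 : L(E)), g)].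
  by rewrite /wsum /rsum !big_seq1 mulop1 regbar1 !mul1r.
Qed.

End RegularRepresentation.

(** * The spaces l_0 and l^infty *)

Lemma l0_sub_linfty {R : realType} (G : choiceType) (D : normedModType R[i])
    (xi : G -> D) :
  xi \in l0_space G D -> xi \in linfty_space G D.
Proof. by move=> /l0_bounded xiM; apply/asboolP. Qed.

Theorem lemma4p4 (R : realType) (X : topologicalType)
    (E : completeNormedModType R[i]) (G : groupType) (t : homeo_action G X)
    (X_nonempty : [set: X] !=set0)
    (X_hausdorff : hausdorff_space X)
    (X_completely_regular : completely_regular_space X)
    (E_nonzero : exists e : E, e != 0)
    (t_free : topologically_free t) :
  regular_isom (l0_reg (E := E) t) /\ regular_isom (linfty_reg (E := E) t).
Proof.
have cE := completeType_seq_complete (E := E); have cD := Cb_seq_complete (X := X) cE.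
(* Both spaces contain l_0(G, D), and both inherit completeness from D. *)
split; apply: regular_isom_of_l0_sub => //.
- exact: l0_seq_complete.
- exact: l0_sub_linfty.
- exact: linfty_seq_complete.
Qed.
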